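(* Every cellular ordinal ballean is asymorphic to some $\gamma$-comb. That is, for every cellular ordinal ballean $\mathcal{B}=(X,P,B)$ there exist ordinals $\lambda,\gamma$ and a function $f:[0,\lambda)\to[0,\gamma)$ satisfying $\sup\{f(t):t\in[0,\alpha]\}<\gamma$ for each $\alpha<\lambda$, such that $\mathcal{B}$ is asymorphic to the ballean $([0,\lambda),[0,\gamma),B_{d_f})$ of the $\gamma$-comb $([0,\lambda),d_f)$.
   Context: **Balleans.** A ball structure is a triple $\mathcal{B}=(X,P,B)$, where $X,P$ are non-empty sets and, for all $x\in X$ and $\alpha\in P$, $B(x,\alpha)$ is a subset of $X$ (the ball of radius $\alpha$ around $x$) with $x\in B(x,\alpha)$. For $x\in X$, $A\subseteq X$, $\alpha\in P$ put $B^*(x,\alpha)=\{y\in X: x\in B(y,\alpha)\}$ and $B(A,\alpha)=\bigcup_{a\in A}B(a,\alpha)$. A ball structure is called a ballean if: (i) for any $\alpha,\beta\in P$ there exist $\alpha',\beta'\in P$ such that, for every $x\in X$, $B(x,\alpha)\subseteq B^*(x,\alpha')$ and $B^*(x,\beta)\subseteq B(x,\beta')$; (ii) for any $\alpha,\beta\in P$ there exists $\gamma\in P$ such that, for every $x\in X$, $B(B(x,\alpha),\beta)\subseteq B(x,\gamma)$; (iii) for any $x,y\in X$ there exists $\alpha\in P$ such that $y\in B(x,\alpha)$. **Asymorphisms.** Let $\mathcal{B}=(X,P,B)$ and $\mathcal{B}'=(X',P',B')$ be balleans. A mapping $h:X\to X'$ is a $\prec$-mapping if for every $\alpha\in P$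 there exists $\alpha'\in P'$ such that $h(B(x,\alpha))\subseteq B'(h(x),\alpha')$ for every $x\in X$. A bijection $h:X\to X'$ is an asymorphism if $h$ and $h^{-1}$ are both $\prec$-mappings; in this case $\mathcal{B}$ and $\mathcal{B}'$ are called asymorphic. **Ordinal balleans.** Given a ballean $\mathcal{B}=(X,P,B)$, define a preorder $<$ on $P$ by: $\alpha<\beta$ if and only if $B(x,\alpha)\subseteq B(x,\beta)$ for each $x\in X$. A subset $P'\subseteq P$ is cofinal if for every $\alpha\in P$ there exists $\alpha'\in P'$ with $\alpha<\alpha'$. The ballean $\mathcal{B}$ is ordinal if there exists a cofinal subset $P'$ of $P$ that is well-ordered by $<$ (here $<$ is reflexive, so it plays the role of the non-strict order relation). **Cellular balleans.** For $x,y\in X$ and $\alpha\in P$, $x$ and $y$ are $\alpha$-path connected if there is a finite sequence $x_0,\ldots,x_n$ with $x_0=x$, $x_n=y$ and $x_{i+1}\in B(x_i,\alpha)$ for each $i\in\{0,\ldots,n-1\}$. Put $B^{\diamond}(x,\alpha)=\{y\in X: x,y \text{ are } \alpha\text{-path connected}\}$; the ballean $\mathcal{B}^{\diamond}=(X,P,B^{\diamond})$ is the cellularization of $\mathcal{B}$. The ballean $\mathcal{B}$ is cellular if the identity map $X\to X$ is an asymorphism between $\mathcal{B}$ and $\mathcal{B}^{\diamond}$. **$\gamma$-combs.** For ordinals, $[\alpha,\beta]=\{t:\alpha\le t\le\beta\}$, $[\alpha,\beta)=\{t:\alpha\le t<\beta\}$, $(\alpha,\beta]=\{t:\alpha<t\le\beta\}$.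 Let $\lambda,\gamma$ be ordinals and let $f:[0,\lambda)\to[0,\gamma)$ be a function such that $\sup\{f(t):t\in[0,\alpha]\}<\gamma$ for each $\alpha<\lambda$. Define $d_f:[0,\lambda)\times[0,\lambda)\to[0,\gamma)$ by $d_f(x,x)=0$ and, if $x<y$, $d_f(x,y)=d_f(y,x)=\sup\{f(t):t\in(x,y]\}$. The pair $([0,\lambda),d_f)$ is called the $\gamma$-comb determined by $f$. It is regarded as the ballean $([0,\lambda),[0,\gamma),B_{d_f})$ with set of radii $[0,\gamma)$ and balls $B_{d_f}(x,\alpha)=\{y\in[0,\lambda): d_f(x,y)\le\alpha\}$. *)

(* Defs.v *)
From HB Require Import structures.
From mathcomp Require Import all_boot all_order.
From mathcomp Require Import boolp classical_sets wochoice.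

Set Implicit Arguments.
Unset Strict Implicit.
Unset Printing Implicit Defensive.

Import Order.TTheory.

Local Open Scope classical_set_scope.
Local Open Scope order_scope.

Record ballStructure := BallStructure {
  bcarrier :> Type;
  radius : Type;
  ball : bcarrier -> radius -> set bcarrier;
  bcarrier_neq0 : inhabited bcarrier;
  radius_neq0 : inhabited radius;
  ball_center : forall x a, ball x a x }.

Arguments ball {b} x a.

Definition ball_star (X : ballStructure) (x : X) (a : radius X) : set X :=
  [set y | ball y a x].

Definition ball_set (X : ballStructure) (A : set X) (a : radius X) : set X :=
  \bigcup_(x in A) ball x a.

Definition ballean_axiom (X : ballStructure) : Prop :=
  [/\ forall a b : radius X, exists a' b' : radius X, forall x : X,
        ball x a `<=` ball_star x a' /\ ball_star x b `<=` ball x b',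
      forall a b : radius X, exists c : radius X, forall x : X,
        ball_set (ball x a) b `<=` ball x c
    & forall x y : X, exists a : radius X, ball x a y].

Record ballean := Ballean {
  bstruct :> ballStructure;
  balleanP : ballean_axiom bstruct }.

Definition prec_mapping (X Y : ballean) (h : X -> Y) : Prop :=
  forall a : radius X, exists b : radius Y, forall x : X,
    h @` ball x a `<=` ball (h x) b.

(* The witness g is the inverse of the bijection h. *)
Definition asymorphism (X Y : ballean) (h : X -> Y) : Prop :=
  exists g : Y -> X,
    [/\ cancel h g, cancel g h, prec_mapping h & prec_mapping g].

Definition asymorphic (X Y : ballean) : Prop :=
  exists h : X -> Y, asymorphism h.

Definition radius_le (X : ballean) (a b : radius X) : Prop :=
  forall x : X, ball x a `<=` ball x b.

Definition radius_cofinal (X : ballean) (P' : {pred radius X}) : Prop :=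
  forall a : radius X, exists2 a', a' \in P' & radius_le a a'.

(* radius_le is only a preorder on all radii; wo_chain asks that every
   non-empty subset of P' have a unique minimum, hence in particular that
   radius_le be antisymmetric and total on P'. *)
Definition ordinal_ballean (X : ballean) : Prop :=
  exists P' : {pred radius X},
    radius_cofinal P' /\
    wo_chain (fun a b : radius X => `[< radius_le a b >]) P'.

Definition path_connected (X : ballStructure) (a : radius X) (x y : X) : Prop :=
  exists (n : nat) (s : nat -> X),
    [/\ s 0%N = x, s n = y
      & forall i, (i < n)%N -> ball (s i) a (s i.+1)].

Lemma path_connected_refl (X : ballStructure) (a : radius X) (x : X) :
  path_connected a x x.
Proof. by exists 0%N, (fun=> x). Qed.

Definition cell_struct (X : ballStructure) : ballStructure :=
  @BallStructure X (radius X) (fun x a => [set y | path_connected a x y])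
    (bcarrier_neq0 X) (radius_neq0 X) (fun x a => path_connected_refl a x).

Lemma path_connected_cons (X : ballStructure) (a : radius X) (x y z : X) :
  ball x a y -> path_connected a y z -> path_connected a x z.
Proof.
move=> xy [n [s [s0 sn sS]]].
exists n.+1, (fun i => if i is j.+1 then s j else x); split=> //.
by case=> [_|i]; [rewrite s0 | exact: sS].
Qed.

Lemma path_connected_ind (X : ballStructure) (a : radius X)
    (R : X -> X -> Prop) :
  (forall x, R x x) -> (forall x y z, ball x a y -> R y z -> R x z) ->
  forall x y, path_connected a x y -> R x y.
Proof.
move=> R0 RS x y [n [s [s0 sn sS]]].
elim: n s x s0 sn sS => [|n IH] s x s0 sn sS; first by rewrite -s0 sn.
rewrite -s0; apply: (RS _ (s 1%N)); first exact: sS.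
by apply: (IH (s \o succn)) => // i /= ltin; apply: sS.
Qed.

Lemma path_connected_trans (X : ballStructure) (a : radius X) (x y z : X) :
  path_connected a x y -> path_connected a y z -> path_connected a x z.
Proof.
move=> xy; move: z; move: x y xy; apply: path_connected_ind => // x y z xy IH t.
by move=> /IH; apply: path_connected_cons.
Qed.

Lemma path_connected_sub (X : ballStructure) (a b : radius X) :
  (forall x : X, ball x a `<=` ball x b) ->
  forall x y : X, path_connected a x y -> path_connected b x y.
Proof.
move=> ab; apply: path_connected_ind; first exact: path_connected_refl.
by move=> x y z xy; apply: path_connected_cons; apply: ab.
Qed.

Lemma path_connected_sym (X : ballStructure) (a b : radius X) :
  (forall x : X, ball x a `<=` ball_star x b) ->
  forall x y : X, path_connected a x y -> path_connected b y x.
Proof.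
move=> ab; apply: path_connected_ind; first exact: path_connected_refl.
move=> x y z xy /path_connected_trans; apply.
by apply: (path_connected_cons (y := x)); [apply: ab | apply: path_connected_refl].
Qed.

Lemma cell_struct_axiom (X : ballean) : ballean_axiom (cell_struct X).
Proof.
have [ax1 ax2 ax3] := balleanP X; split=> /=.
- move=> a b; have [a' [a0 aa']] := ax1 a a; have [b0 [b' bb']] := ax1 b b.
  exists a', b' => x; split=> y /=.
    exact: (path_connected_sym (fun z => (aa' z).1)).
  exact: (path_connected_sym (fun z t => (bb' t).2 z)).
- move=> a b; have [c abc] := ax2 a b; exists c => x y [z /= xz zy].
  apply: (@path_connected_trans X c x z y).
    apply: path_connected_sub xz => t u tu; apply: (abc t).
    by exists u => //; apply: ball_center.
  apply: path_connected_sub zy => t u tu; apply: (abc t).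
  by exists t => //; apply: ball_center.
- move=> x y; have [a xy] := ax3 x y; exists a.
  by apply: path_connected_cons xy _; apply: path_connected_refl.
Qed.

Definition cellularization (X : ballean) : ballean :=
  Ballean (cell_struct_axiom X).

Definition cellular (X : ballean) : Prop :=
  @asymorphism X (cellularization X) (fun x => x).

(* An ordinal delta is represented by a well-ordered type of order type delta,
   standing for the interval [0, delta) of its predecessors; every
   well-ordered type arises from exactly one delta. *)
Record ordinalType := OrdinalType {
  ord_disp : Order.disp_t;
  ord_sort :> orderType ord_disp;
  ord_wo : well_order (<=%O : rel ord_sort) }.

(* The ordinal 0, as an element of a segment inhabited by a. *)
Definition ord_zero (g : ordinalType) (a : g) : g := infimum a [set: g].

(* sup {f(t) : t in [0, a]} < g: the supremum is itself an element of [0, g). *)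
Definition comb_function (l g : ordinalType) (f : l -> g) : Prop :=
  forall a : l, exists s : g, supremums (f @` [set t | t <= a]) s.

(* For f a comb function the suprema below exist, so the default value of
   supremum is not used. *)
Definition comb_dist (l g : ordinalType) (f : l -> g) (x y : l) : g :=
  let zero := ord_zero (f x) in
  if x < y then supremum zero (f @` [set t | x < t <= y])
  else if y < x then supremum zero (f @` [set t | y < t <= x])
  else zero.

Definition comb_ball (l g : ordinalType) (f : l -> g) (x : l) (a : g) : set l :=
  [set y | comb_dist f x y <= a].

Lemma ord_min (g : ordinalType) (A : set g) :
  A !=set0 -> exists2 m, A m & forall b, A b -> m <= b.
Proof.
move=> [a Aa]; pose A' := [pred x : g | `[< A x >]].
have [|m [[mA mmin] _]] := @ord_wo g A'; first by exists a; apply/asboolP.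
exists m => [|b Ab]; first exact/asboolP.
by apply: mmin; apply/asboolP.
Qed.

Lemma ord_zero_le (g : ordinalType) (a b : g) : ord_zero a <= b.
Proof.
have [|m _ mmin] := @ord_min g [set: g]; first by exists a.
rewrite /ord_zero /infimum; case: ifPn => [/eqP T0|_].
  by have : [set: g] a by []; rewrite T0.
by case: xgetP => [z _ [zlb _]|/(_ m)[]]; [apply: zlb | split=> [c _|c clb]; [apply: mmin | apply: clb]].
Qed.

Lemma supremum_le (g : ordinalType) (z s a : g) (A : set g) :
  A !=set0 -> ubound A s -> supremum z A <= a <-> ubound A a.
Proof.
move=> A0 As; have [|m Am mmin] := @ord_min g (ubound A); first by exists s.
have supm : supremums A m by split.
rewrite /supremum; case: ifPn => [/eqP AE|_]; first by case: A0; rewrite AE.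
case: xgetP => [u _ [uA umin]|/(_ m)//]; split=> [ua b Ab|]; last exact: umin.
by rewrite (le_trans _ ua)// uA.
Qed.

Section Comb.
Variables (l g : ordinalType) (f : l -> g).
Hypothesis f_comb : comb_function f.

Lemma comb_dist_le (x y : l) (a : g) :
  comb_dist f x y <= a <->
  forall t, (x < t <= y) || (y < t <= x) -> f t <= a.
Proof.
have sup_le (u v : l) z : u < v ->
    supremum z (f @` [set t | u < t <= v]) <= a <-> forall t, u < t <= v -> f t <= a.
  move=> uv; have [s [fs _]] := f_comb v.
  rewrite (@supremum_le g z s a).
  - split=> [ub t utv|ub _ [t utv <-]].
      by apply: ub; exists t.
    exact: ub.
  - by exists (f v), v => //=; rewrite uv lexx.
  - move=> _ [t utv <-]; apply: fs; exists t => //=.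
    by case/andP: utv.
rewrite /comb_dist; case: (ltgtP x y) => [xy|yx|<-].
- rewrite sup_le//; split=> H t tP; apply: H; last by rewrite tP.
  case/orP: tP => // /andP[yt tx].
  by move: (lt_le_trans yt tx) => /(lt_trans xy); rewrite ltxx.
- rewrite sup_le//; split=> H t tP; apply: H; last by rewrite tP orbT.
  case/orP: tP => // /andP[yt tx].
  by move: (lt_le_trans yt tx) => /(lt_trans yx); rewrite ltxx.
- split=> [_ t|_]; last exact: ord_zero_le.
  by rewrite orbb => /andP[xt]; rewrite leNgt xt.
Qed.

Hypothesis l_neq0 : inhabited l.

Lemma comb_radius_neq0 : inhabited g.
Proof. by case: l_neq0 => x; exists; apply: f. Qed.

Lemma comb_ball_center (x : l) (a : g) : comb_ball f x a x.
Proof. by rewrite /comb_ball /= /comb_dist ltxx ord_zero_le. Qed.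

Definition comb_struct : ballStructure :=
  @BallStructure l g (comb_ball f) l_neq0 comb_radius_neq0 comb_ball_center.

Lemma comb_struct_axiom : ballean_axiom comb_struct.
Proof.
have sym (x y : l) a : comb_dist f x y <= a -> comb_dist f y x <= a.
  by rewrite !comb_dist_le => H t; rewrite orbC; apply: H.
split=> /=.
- by move=> a b; exists a, b => x; split=> y; apply: sym.
- move=> a b; exists (Order.max a b) => x y [z xz zy].
  move: xz zy; rewrite /= /comb_ball /= !comb_dist_le => xz zy t xty.
  rewrite le_max; case: (ltP z t) => zt; apply/orP; case/orP: xty => /andP[h1 h2].
  + by right; apply: zy; rewrite zt h2.
  + by left; apply: xz; rewrite zt h2 orbT.
  + by left; apply: xz; rewrite h1 zt.
  + by right; apply: zy; rewrite h1 zt orbT.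
- by move=> x y; exists (comb_dist f x y); apply: lexx.
Qed.

Definition comb_ballean : ballean := Ballean comb_struct_axiom.

End Comb.

(* Main.v *)
Require Import Defs.
From HB Require Import structures.
From mathcomp Require Import all_boot all_order.
From mathcomp Require Import boolp classical_sets wochoice.

Set Implicit Arguments.
Unset Strict Implicit.
Unset Printing Implicit Defensive.

Import Order.TTheory.
Local Open Scope classical_set_scope.
Local Open Scope order_scope.

(** The idea is to measure B by an ultrametric with values in an ordinal, and then
    to well-order the points so that all balls of this ultrametric are convex.

    A cellular ballean has the same coarse structure as its relations of mutual
    path-connectedness, which are equivalence relations.  Along a well-ordered
    cofinal set of radii they form an increasing chain, so the least radius at
    which x and y are equivalent is a pseudo-ultrametric d with ordinal values.
    It determines B up to asymorphism, and the theorem becomes a statement on d: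
    every such d is a comb distance ([ultrametric_comb]).

    If the points are well-ordered with all balls convex, then d is the comb
    distance of the function that sends t to the least distance from t to an
    earlier point: unless t is the first of all points, this value is at most a
    exactly when t is not the first point of its closed a-ball, so staying at most a on the interval from x to y, x
    excluded, means that no new ball begins between x and y
    ([convex_comb]).

    It remains to find such a well-order.  Start from an arbitrary well-order W
    and call the W-least point of an open ball its leader.  Two distinct points at
    distance a lie in disjoint open a-balls; compare them as the leaders of these
    balls are compared by W.  Balls are convex for any coherent
    comparison of this kind; the use of leaders is what makes it a well-order.
    Indeed the leader of a ball is also the leader of each smaller ball around it,
    so inside a ball all the balls around the leader are initial segments, and
    a descending sequence that starts in one of them cannot leave it.  Hence
    least elements can be found by induction on the radius
    ([leader_le_least_bounded]). *)

(** * Ordinals from well-orders *)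

(** Reflexivity, transitivity and totality come for free from the least elements
    of sets with one, three and two points. *)
Lemma ordinal_of_least (T : Type) (R : T -> T -> Prop) :
  (forall x y, R x y -> R y x -> x = y) ->
  (forall A : set T, A !=set0 -> exists2 m, A m & forall x, A x -> R m x) ->
  exists (L : ordinalType) (h : T -> L) (k : L -> T),
    [/\ cancel h k, cancel k h & forall x y, (h x <= h y) <-> R x y].
Proof.
move=> Ranti Rleast.
pose le : rel {classic T} := fun x y => `[< R x y >].
have le_refl : reflexive le.
  move=> x; have [|_ -> Rx] := Rleast [set x]; first by exists x.
  by apply/asboolP; apply: Rx.
have le_anti : antisymmetric le.
  by move=> x y /andP[/asboolP Rxy /asboolP]; apply: Ranti.
have le_trans : transitive le.
  move=> y x z /asboolP Rxy /asboolP Ryz; apply/asboolP.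
  have [|m [[]|] -> Rm] := Rleast ([set x] `|` [set y] `|` [set z]).
  - by exists x; do 2 left.
  - by apply: Rm; right.
  - by rewrite (Ranti x y)//; apply: Rm; do 2 left.
  - by rewrite -(Ranti y z)//; apply: Rm; left; right.
have le_total : total le.
  move=> x y; apply/orP.
  have [|m [] -> Rm] := Rleast ([set x] `|` [set y]); first by exists x; left.
  - by left; apply/asboolP; apply: Rm; right.
  - by right; apply/asboolP; apply: Rm; left.
pose PO : porderType (Order.Disp tt tt) := HB.pack {classic T}
  (@Order.Le_isPOrder.Build (Order.Disp tt tt) {classic T} le
     le_refl le_anti le_trans).
pose O : orderType (Order.Disp tt tt) := HB.pack PO
  (@Order.POrder_isTotal.Build (Order.Disp tt tt) PO le_total).
have O_wo : well_order (<=%O : rel O).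
  apply: (@antisymmetric_well_order O <=%O le_anti) => A [a Aa].
  have [|m Am mle] := Rleast [set x | x \in A]; first by exists a.
  by exists m; split=> // x Ax; apply/asboolP; apply: mle.
exists (OrdinalType O_wo), (fun x => x), (fun x => x).
by split=> // x y; split=> [/asboolP //|Rxy]; apply/asboolP.
Qed.

Lemma ordinal_of_type (T : Type) :
  exists (L : ordinalType) (h : T -> L) (k : L -> T), cancel h k /\ cancel k h.
Proof.
have [R Rwo] := well_ordering_principle {classic T}.
have Rch : wo_chain R predT by move=> A _; apply: Rwo.
have [] := @ordinal_of_least T R.
- have anti := wo_chain_antisymmetric Rch.
  by move=> x y Rxy Ryx; apply: anti; rewrite ?inE ?Rxy.
- move=> A [a Aa]; have [|m [[/asboolP Am mle] _]] := Rwo [pred x | `[< A x >]].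
    by exists a; apply/asboolP.
  by exists m => // x Ax; apply: mle; apply/asboolP.
- by move=> L [h [k [hk kh _]]]; exists L, h, k.
Qed.

Lemma ord_ind (g : ordinalType) (P : g -> Prop) :
  (forall a, (forall b, b < a -> P b) -> P a) -> forall a, P a.
Proof.
move=> PS a; apply: contrapT => nPa.
have [|m nPm mmin] := @ord_min g [set b | ~ P b]; first by exists a.
apply: nPm; apply: PS => b; apply: contraPP => nPb.
by apply/negP; rewrite -leNgt mmin.
Qed.

(** * A convex ultrametric is a comb distance *)

Section ConvexComb.
Variables (L g : ordinalType) (d : L -> L -> g).
Hypothesis dxx : forall x a, d x x <= a.
Hypothesis d_sym : forall x y, d x y = d y x.
Hypothesis d_ultra : forall x y z, d x z <= Order.max (d x y) (d y z).
Hypothesis d_convex : forall x y z, x <= y <= z -> d x y <= d x z.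

(** The value of the comb function at t: the least distance from t to an earlier
    point, and 0 when t is the first point.  It is at most b exactly when t
    is the first point of L or is not the first point of its closed b-ball. *)
Lemma height_exists (t : L) : exists a : g, forall b,
  a <= b <-> (forall s, t <= s) \/ exists2 s, s < t & d s t <= b.
Proof.
have [tmin|/existsNP[s /negP]] := pselect (forall s, t <= s).
  by exists (d t t) => b; split=> [_|_]; [left | apply: dxx].
rewrite -ltNge => st.
have [|_ [u ut <-] umin] := @ord_min g ((d ^~ t) @` [set u | u < t]).
  by exists (d s t), s.
exists (d u t) => b; split=> [ub|[tmin|[v vt]]]; first by right; exists u.
  by have := tmin s; rewrite leNgt st.
by apply: le_trans; apply: umin; exists v.
Qed.

Lemma convex_comb :
  exists (f : L -> g), comb_function f /\
    forall x y a, comb_dist f x y <= a <-> d x y <= a.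
Proof.
have [f fP] := choice height_exists.
have f_le s t : s < t -> f t <= d s t by move=> st; apply/fP; right; exists s.
have d_convex_r x y z : x <= y <= z -> d y z <= d x z.
  move=> xyz; rewrite (le_trans (d_ultra y x z))// ge_max lexx andbT d_sym.
  exact: d_convex.
have fc : comb_function f.
  move=> x; have [|m _ mmin] := @ord_min L setT; first by exists x.
  (* On [m, x], with m the first point, f is bounded by d m x, by convexity. *)
  have [|s sub smin] := @ord_min g (ubound (f @` [set t | t <= x])).
    exists (d m x) => _ [t /= tx <-].
    have [mt|tm] := ltP m t.
      by rewrite (le_trans (f_le _ _ mt))// d_convex// (ltW mt).
    by apply/fP; left=> s; rewrite (le_trans tm)// mmin.
  by exists s; split.
exists f; split=> //.
have key x y a : x <= y ->
    (forall t, x < t <= y -> f t <= a) <-> d x y <= a.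
  move=> xy; split=> [fa|dxy t /andP[xt ty]]; last first.
    by rewrite (le_trans (f_le _ _ xt))// (le_trans _ dxy)// d_convex// (ltW xt).
  (* If the first point t of the a-ball of y came after x, then f t <= a would
     yield an even earlier point of this ball. *)
  have [|t /= ta tmin] := @ord_min L [set t | d t y <= a].
    by exists y; apply: dxx.
  have ty : t <= y by apply: tmin; apply: dxx.
  have [tx|xt] := leP t x.
    by rewrite (le_trans _ ta)// d_convex_r// tx.
  have := fa t; rewrite xt ty => /(_ isT)/fP[/(_ x)|[s st sa]].
    by rewrite leNgt xt.
  suff : t <= s by rewrite leNgt st.
  by apply: tmin; rewrite /= (le_trans (d_ultra s t y))// ge_max sa.
move=> x y a; rewrite comb_dist_le//.
have [xy|/ltW yx] := leP x y.
  rewrite -key//; split=> fa t; first by move=> txy; apply: fa; rewrite txy.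
  case/orP=> [|/andP[yt tx]]; first exact: fa.
  by have := lt_le_trans yt (le_trans tx xy); rewrite ltxx.
rewrite d_sym -key//; split=> fa t.
  by move=> txy; apply: fa; rewrite txy orbT.
case/orP=> [/andP[xt ty]|]; last exact: fa.
by have := lt_le_trans xt (le_trans ty yx); rewrite ltxx.
Qed.
End ConvexComb.

(** * The leader order *)

Section LeaderOrder.
Variables (X g : ordinalType) (d : X -> X -> g).
Hypothesis d_sym : forall x y, d x y = d y x.
Hypothesis d_ultra : forall x y z, d x z <= Order.max (d x y) (d y z).

(** The centre is added by hand because d x x < a fails for a = 0, and because the
    distance of two distinct points may be 0: the open 0-balls are to be
    singletons. *)
Definition open_ball (a : g) (x : X) : set X := [set z | z = x \/ d x z < a].

Lemma open_ball_eq a x y : open_ball a x y -> open_ball a x = open_ball a y.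
Proof.
case=> [-> //|xy]; have yx : d y x < a by rewrite d_sym.
have sub u v : d u v < a -> open_ball a u `<=` open_ball a v.
  move=> uv z; have vu : d v u < a by rewrite d_sym.
  case=> [->|uz]; right; rewrite //.
  by rewrite (le_lt_trans (d_ultra v u z))// gt_max vu.
by apply/seteqP; split; apply: sub.
Qed.

Definition leader (a : g) (x : X) : X :=
  xget x [set m | open_ball a x m /\ lbound (open_ball a x) m].

Lemma leaderP a x : open_ball a x (leader a x) /\ lbound (open_ball a x) (leader a x).
Proof.
rewrite /leader; case: xgetP => [m _ //|none].
have [|m xm mle] := @ord_min X (open_ball a x); first by exists x; left.
by case: (none m).
Qed.

Lemma leader_eq a x y : open_ball a x y -> leader a x = leader a y.
Proof.
move=> xy; apply/le_anti; apply/andP; split.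
  by apply: (leaderP a x).2; rewrite (open_ball_eq xy); apply: (leaderP a y).1.
by apply: (leaderP a y).2; rewrite -(open_ball_eq xy); apply: (leaderP a x).1.
Qed.

Lemma leader_inj a x y : leader a x = leader a y -> open_ball a x y.
Proof.
move=> xy; rewrite (open_ball_eq (leaderP a x).1) xy.
by rewrite -(open_ball_eq (leaderP a y).1); left.
Qed.

Lemma leader_mono a b x : a <= b -> leader b x <= leader a x.
Proof.
move=> ab; apply: (leaderP b x).2; case: (leaderP a x).1 => [->|xl]; first by left.
by right; apply: lt_le_trans ab.
Qed.

Definition leader_le (x y : X) : Prop :=
  leader (d x y) x <= leader (d x y) y.

(** Distinct points lie in disjoint open balls of radius their distance, and these
    have distinct leaders. *)
Lemma leader_le_anti x y : leader_le x y -> leader_le y x -> x = y.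
Proof.
rewrite /leader_le d_sym => xy yx.
by case: (@leader_inj (d y x) y x) => //; [apply/le_anti; rewrite xy yx | rewrite ltxx].
Qed.

Lemma ultra_isosceles x y z : d x y < d x z -> d y z = d x z.
Proof.
move=> lt; apply/le_anti/andP; split.
  rewrite (le_trans (d_ultra y x z))// ge_max lexx andbT d_sym ltW//.
by have := d_ultra x y z; rewrite le_max [d x z <= d x y]leNgt lt.
Qed.

(** If z were closer to x than y is, then x and z would lie in the same open ball of
    radius d x y, hence compare with y in the same way. *)
Lemma leader_le_convex x y z : leader_le x y -> leader_le y z -> d x y <= d x z.
Proof.
move=> xy yz; rewrite leNgt; apply/negP => lt.
have zy : leader_le z y.
  rewrite /leader_le (ultra_isosceles lt) -(@leader_eq (d x y) x z)//.
  by right.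
by move: lt; rewrite (leader_le_anti yz zy) ltxx.
Qed.

(** A set A that meets the closed b-ball of k has a least element as soon as its part
    in this ball has one, provided that k is a lower bound of the leaders that
    occur in A.  Let m be least in this part: a point y of A outside the ball
    is farther from m than k is, so the leader on the side of m is at most k. *)
Lemma leader_le_least_extend (A : set X) (k x : X) (b : g) :
  (forall m y, A m -> A y -> k <= leader (d m y) y) ->
  (forall A : set X, A !=set0 -> (forall x y, A x -> A y -> d x y <= b) ->
    exists2 m, A m & forall y, A y -> leader_le m y) ->
  A x -> d k x <= b ->
  exists2 m, A m & forall y, A y -> leader_le m y.
Proof.
move=> kA least Ax kx.
have [||m [Am km] mle] := least [set y | A y /\ d k y <= b].
- by exists x.
- by move=> y z [_ ky] [_ kz]; rewrite (le_trans (d_ultra y k z))// ge_max d_sym ky.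
exists m => // y Ay; have [ky|b_lt] := leP (d k y) b; first exact: mle.
apply: le_trans (kA m y Am Ay); apply: (leaderP _ _).2.
have lt := le_lt_trans km b_lt.
by right; rewrite (ultra_isosceles lt) d_sym.
Qed.

(** Let k be the least leader of an open a-ball that meets A, say at x.  If k = x,
    then x is its own leader and precedes all of A.  Otherwise b = d x k < a, and the closed b-ball of k meets
    A and is covered by the induction hypothesis. *)
Lemma leader_le_least_bounded (a : g) (A : set X) :
  A !=set0 -> (forall x y, A x -> A y -> d x y <= a) ->
  exists2 m, A m & forall y, A y -> leader_le m y.
Proof.
elim/ord_ind: a A => a IH A [x1 Ax1] dA.
have [|_ [x Ax <-] kmin] := @ord_min X (leader a @` A).
  by exists (leader a x1), x1.
have kA m y : A m -> A y -> leader a x <= leader (d m y) y.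
  move=> Am Ay; apply: (@le_trans _ _ (leader a y)); last exact/leader_mono/dA.
  by apply: kmin; exists y.
case: (leaderP a x).1 => [kx|xk].
  exists x => // y Ay; apply: le_trans (kA x y Ax Ay).
  by apply: (leaderP _ _).2; left.
apply: (@leader_le_least_extend A (leader a x) x (d x (leader a x))) => //.
- exact: IH.
- by rewrite d_sym.
Qed.

Lemma leader_le_least (A : set X) :
  A !=set0 -> exists2 m, A m & forall y, A y -> leader_le m y.
Proof.
move=> [x Ax]; have [|k _ kmin] := @ord_min X setT; first by exists x.
apply: (@leader_le_least_extend A k x (d k x)) => //.
- by move=> m y _ _; apply: kmin.
- exact: leader_le_least_bounded.
Qed.
End LeaderOrder.

(** Leaders require an initial well-order, so T is first identified with an ordinal
    W; the leader order is then a second well-order on the same points. *)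
Lemma ultrametric_comb (T : Type) (g : ordinalType) (d : T -> T -> g) :
  (forall x a, d x x <= a) -> (forall x y, d x y = d y x) ->
  (forall x y z, d x z <= Order.max (d x y) (d y z)) ->
  exists (L : ordinalType) (h : T -> L) (k : L -> T) (f : L -> g),
    [/\ cancel h k, cancel k h, comb_function f &
      forall x y a, comb_dist f (h x) (h y) <= a <-> d x y <= a].
Proof.
move=> dxx d_sym d_ultra.
have [W [u [v [uv vu]]]] := ordinal_of_type T.
pose dW (x y : W) := d (v x) (v y).
have dW_sym x y : dW x y = dW y x by apply: d_sym.
have dW_ultra x y z : dW x z <= Order.max (dW x y) (dW y z) by apply: d_ultra.
have [||L [h [k [hk kh hle]]]] := @ordinal_of_least W (leader_le dW).
- exact: leader_le_anti.
- exact: leader_le_least.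
have [||||f [fc fd]] := @convex_comb L g (fun x y => dW (k x) (k y)).
- by move=> x a; apply: dxx.
- by move=> x y; apply: dW_sym.
- by move=> x y z; apply: dW_ultra.
- move=> x y z /andP[xy yz].
  by apply: leader_le_convex => //; apply/hle; rewrite !kh.
exists L, (h \o u), (v \o k), f; split => //.
- exact: can_comp.
- exact: can_comp.
- by move=> x y a; rewrite fd /= !hk /dW !uv.
Qed.

(** * Mutual path-connectedness in a ballean *)

Section Balleans.
Variable B : ballean.

(** Path-connectedness at one radius need not be symmetric, as balls are not
    symmetric; requiring both directions gives an equivalence relation. *)
Definition mutual (a : radius B) (x y : B) : Prop :=
  path_connected a x y /\ path_connected a y x.

Lemma mutual_sym a x y : mutual a x y -> mutual a y x.
Proof. by case. Qed.

Lemma mutual_trans a x y z : mutual a x y -> mutual a y z -> mutual a x z.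
Proof. by move=> [xy yx] [yz zy]; split; apply: path_connected_trans; eassumption. Qed.

Lemma mutual_mono a b x y : radius_le a b -> mutual a x y -> mutual b x y.
Proof. by move=> ab [xy yx]; split; apply: path_connected_sub ab _ _ _. Qed.

(** The radius b is chosen so that the b-balls contain both the a-balls and their
    converses. *)
Lemma ball_mutual a : exists b, forall x y, ball x a y -> mutual b x y.
Proof.
have [ax1 ax2 _] := balleanP B.
have [a' [a'' aa']] := ax1 a a; have [c ac] := ax2 a a'; exists c => x y xy.
have path1 u v : ball u c v -> path_connected c u v.
  by move=> uv; apply: path_connected_cons uv _; apply: path_connected_refl.
split; apply: path1; apply: ac.
  by exists y => //; apply: ball_center.
by exists y; [apply: ball_center | apply: (aa' x).1].
Qed.
End Balleans.

Theorem mainTheorem1 (B : ballean) :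
  cellular B -> ordinal_ballean B ->
  exists (lambda gamma : ordinalType) (f : lambda -> gamma)
    (f_comb : comb_function f) (lambda_neq0 : inhabited lambda),
    asymorphic B (comb_ballean f_comb lambda_neq0).
Proof.
move=> [g [_ gK _ id_prec]] [P' [P'cof P'wo]].
have gid x : g x = x by rewrite -[RHS]gK.
have mutual_ball a : exists b : radius B, forall x y, mutual a x y -> ball x b y.
  have [b gb] := id_prec a; exists b => x y [xy _].
  by have := gb x y; rewrite !gid; apply; exists y.
pose Q := {a : radius B | a \in P'}.
have [||G [h [k [hk kh hle]]]] :=
    @ordinal_of_least Q (fun a b => radius_le (sval a) (sval b)).
- have anti := @wo_chain_antisymmetric {classic radius B} _ _ P'wo.
  move=> [a aP] [b bP] /= ab ba; apply: eq_exist.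
  by apply: anti => //; apply/andP; split; apply/asboolP.
- move=> A [q Aq].
  have [||m [[/asboolP[qm Aqm <-] mle] _]] :=
      P'wo [pred a | `[< exists2 q, A q & sval q = a >]].
  + by move=> b /asboolP[r _ <-]; apply: (svalP r).
  + by exists (sval q); apply/asboolP; exists q.
  exists qm => // r Ar; apply/asboolP; apply: mle.
  by apply/asboolP; exists r.
pose E (a : G) := mutual (sval (k a)).
have E_cof a : exists b : G, forall x y, ball x a y -> E b x y.
  have [b ab] := ball_mutual a; have [c cP bc] := P'cof b.
  exists (h (exist _ c cP)) => x y /ab; rewrite /E hk; exact: mutual_mono.
have E_mono (a b : G) x y : a <= b -> E a x y -> E b x y.
  move=> ab; apply: mutual_mono.
  by apply/(hle (k a) (k b)); rewrite !kh.
have [d dP] : exists d : B -> B -> G, forall x y a, d x y <= a <-> E a x y.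
  suff /choice[d dP] : forall p : B * B, exists m : G,
      forall a, m <= a <-> E a p.1 p.2.
    by exists (fun x y => d (x, y)) => x y a; apply: (dP (x, y)).
  move=> [x y] /=; have [_ _ /(_ x y)[a /= xy]] := balleanP B.
  have [b ab] := E_cof a.
  have [|m Em mmin] := @ord_min G [set c | E c x y]; first by exists b; apply: ab.
  by exists m => c; split=> [mc|]; [apply: E_mono Em | apply: mmin].
have [||| L [u [v [f [uv vu fc fd]]]]] := @ultrametric_comb B G d.
- by move=> x a; apply/dP; split; apply: path_connected_refl.
- have sub x y : d x y <= d y x by apply/dP/mutual_sym/dP.
  by move=> x y; apply/le_anti; rewrite !sub.
- move=> x y z; apply/dP; apply: (@mutual_trans B _ x y z).
    by apply: E_mono (proj1 (dP x y _) (lexx _)); rewrite le_max lexx.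
  by apply: E_mono (proj1 (dP y z _) (lexx _)); rewrite le_max lexx orbT.
have L0 : inhabited L by case: (bcarrier_neq0 B) => x; exists; exact (u x).
exists L, G, f, fc, L0, u, v; split=> //.
- move=> a; have [b ab] := E_cof a; exists b => x _ [y /ab Exy <-].
  exact/fd/dP.
- move=> a; have [b ab] := mutual_ball (sval (k a)).
  exists b => x _ [y xy <-]; apply: ab; apply/dP/fd.
  by rewrite !vu.
Qed.
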